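(* The $3$-adic generalized exceptional set $\mathcal{E}_\star(\mathbb{Z}_3)$ satisfies $$\dim_H(\mathcal{E}_\star(\mathbb{Z}_3))\ge\tfrac12\log_3 2\approx0.315464.$$ In fact, with $N_m=3^m+1$, $$\dim_H\left(\{\lambda\in\Sigma_{3,\bar2}: N_{2k+1}\lambda\in\Sigma_{3,\bar2}\ \text{for all } k\ge1\}\right)\ge\tfrac12\log_3 2.$$
   Context: $\mathbb{Z}_3$ denotes the $3$-adic integers with the $3$-adic metric ($|3|_3=1/3$), and $\dim_H$ is Hausdorff dimension with respect to it. $\Sigma_{3,\bar2}\subset\mathbb{Z}_3$ is the set of all $\sum_{j\ge0}a_j3^j$ with every $a_j\in\{0,1\}$ (the $3$-adic integers whose expansion omits the digit $2$). The $3$-adic generalized exceptional set $\mathcal{E}_\star(\mathbb{Z}_3)$ is the set of $\lambda\in\mathbb{Z}_3$ such that there are infinitely many integers $M\ge1$ with $M\not\equiv0\pmod3$, including $M=1$, for which $M\lambda\in\Sigma_{3,\bar2}$. *)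

(* Defs.v *)
From HB Require Import structures.
From mathcomp Require Import all_boot all_order all_algebra.
From mathcomp Require Import all_classical all_reals all_analysis.

Set Implicit Arguments.
Unset Strict Implicit.
Unset Printing Implicit Defensive.

Import Order.TTheory GRing.Theory Num.Theory.
Import numFieldNormedType.Exports.

Local Open Scope classical_set_scope.
Local Open Scope ring_scope.

Definition compatible3 (x : nat -> int) : Prop :=
  forall n, x n = (x n.+1 %% 3 ^+ n)%Z.

(* The inverse limit of the rings Z/3^n: [res3 x n] is the representative in
   [0, 3^n) of the class of [x] modulo 3^n. *)
Record Z3 := MkZ3 { res3 : nat -> int ; res3P : `[< compatible3 res3 >] }.

HB.instance Definition _ := [isSub for res3].
HB.instance Definition _ := [Choice of Z3 by <:].

Lemma res3E (x : Z3) n : (res3 x n.+1 %% 3 ^+ n)%Z = res3 x n.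
Proof. by have /asboolP/(_ n) := res3P x. Qed.

Lemma res3_mod (x : Z3) n : (res3 x n %% 3 ^+ n)%Z = res3 x n.
Proof. by rewrite -res3E modz_mod. Qed.

Lemma Z3_eqP (x y : Z3) : (forall n, res3 x n = res3 y n) -> x = y.
Proof. by move=> xy; apply: val_inj; apply/funext. Qed.

Lemma modz_pow3S (a : int) n :
  ((a %% 3 ^+ n.+1)%Z %% 3 ^+ n)%Z = (a %% 3 ^+ n)%Z.
Proof.
by rewrite {2}(divz_eq a (3 ^+ n.+1)) exprS mulrA modzMDl.
Qed.

Lemma trunc3_subproof (f : nat -> int) :
  (forall n, (f n.+1 %% 3 ^+ n = f n %% 3 ^+ n)%Z) ->
  `[< compatible3 (fun n => (f n %% 3 ^+ n)%Z) >].
Proof. by move=> fP; apply/asboolP => n; rewrite modz_pow3S fP. Qed.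

Lemma opp3_subproof (x : Z3) n :
  ((- res3 x n.+1) %% 3 ^+ n = (- res3 x n) %% 3 ^+ n)%Z.
Proof. by rewrite -modzNm res3E. Qed.

Lemma add3_subproof (x y : Z3) n :
  ((res3 x n.+1 + res3 y n.+1) %% 3 ^+ n
    = (res3 x n + res3 y n) %% 3 ^+ n)%Z.
Proof. by rewrite -modzDm !res3E. Qed.

Lemma mul3_subproof (x y : Z3) n :
  ((res3 x n.+1 * res3 y n.+1) %% 3 ^+ n
    = (res3 x n * res3 y n) %% 3 ^+ n)%Z.
Proof. by rewrite -modzMm !res3E. Qed.

Definition zero3 : Z3 :=
  @MkZ3 (fun n => (0 %% 3 ^+ n)%Z) (@trunc3_subproof (fun=> 0) (fun=> erefl)).
Definition one3 : Z3 :=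
  @MkZ3 (fun n => (1 %% 3 ^+ n)%Z) (@trunc3_subproof (fun=> 1) (fun=> erefl)).
Definition opp3 (x : Z3) : Z3 := MkZ3 (trunc3_subproof (opp3_subproof x)).
Definition add3 (x y : Z3) : Z3 := MkZ3 (trunc3_subproof (add3_subproof x y)).
Definition mul3 (x y : Z3) : Z3 := MkZ3 (trunc3_subproof (mul3_subproof x y)).

Lemma add3A : associative add3.
Proof. by move=> x y z; apply: Z3_eqP => n /=; rewrite modzDml modzDmr addrA. Qed.

Lemma add3C : commutative add3.
Proof. by move=> x y; apply: Z3_eqP => n /=; rewrite addrC. Qed.

Lemma add03 : left_id zero3 add3.
Proof. by move=> x; apply: Z3_eqP => n /=; rewrite mod0z add0r res3_mod. Qed.

Lemma addN3 : left_inverse zero3 opp3 add3.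
Proof. by move=> x; apply: Z3_eqP => n /=; rewrite modzDml addNr. Qed.

Lemma mul3A : associative mul3.
Proof. by move=> x y z; apply: Z3_eqP => n /=; rewrite modzMml modzMmr mulrA. Qed.

Lemma mul3C : commutative mul3.
Proof. by move=> x y; apply: Z3_eqP => n /=; rewrite mulrC. Qed.

Lemma mul13 : left_id one3 mul3.
Proof. by move=> x; apply: Z3_eqP => n /=; rewrite modzMml mul1r res3_mod. Qed.

Lemma mul3Dl : left_distributive mul3 add3.
Proof.
by move=> x y z; apply: Z3_eqP => n /=; rewrite modzMml modzDm mulrDl.
Qed.

Lemma one3_neq0 : one3 != zero3.
Proof. by apply/eqP => /(congr1 (fun x => res3 x 1)). Qed.

HB.instance Definition _ := GRing.isZmodule.Build Z3 add3A add3C add03 addN3.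
HB.instance Definition _ := GRing.Zmodule_isComNzRing.Build Z3
  mul3A mul3C mul13 mul3Dl one3_neq0.

Lemma res3D (x y : Z3) n :
  res3 (x + y) n = ((res3 x n + res3 y n) %% 3 ^+ n)%Z.
Proof. by []. Qed.

Lemma res3B (x y : Z3) n :
  res3 (x - y) n = ((res3 x n - res3 y n) %% 3 ^+ n)%Z.
Proof. by rewrite /= modzDmr. Qed.

Lemma res3B_eq0 (x y : Z3) n : (res3 (x - y) n == 0) = (res3 x n == res3 y n).
Proof.
apply/eqP/eqP => [|xy]; last by rewrite res3B xy subrr mod0z.
by move=> h; rewrite -[x](subrK y) res3D h add0r res3_mod.
Qed.

Lemma res3_eq_le (x y : Z3) m n : (m <= n)%N ->
  res3 x n = res3 y n -> res3 x m = res3 y m.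
Proof.
elim: n => [|n ih]; first by rewrite leqn0 => /eqP ->.
rewrite leq_eqVlt => /predU1P[->//|mn] xy.
by apply: ih => //; rewrite -res3E xy res3E.
Qed.

(* [v(x)]: the largest [n] such that 3^n divides [x] (and 0 if [x] = 0). *)
Definition val3 (x : Z3) : nat :=
  if pselect (exists n, res3 x n.+1 != 0) is left h then ex_minn h else 0.

Definition norm3 (R : realType) (x : Z3) : R :=
  if x == 0 then 0 else 3 ^- val3 x.

Section topology.
Local Open Scope relation_scope.

(* The profinite uniformity; its entourages are generated by the congruences
   modulo 3^n. It is proved below to be the one of the metric [norm3 (x - y)];
   it is introduced first because it does not depend on the real field R. *)
Definition cong3 (n : nat) : set (Z3 * Z3) :=
  [set xy | res3 xy.1 n = res3 xy.2 n].

Definition entourage3 : set_system (Z3 * Z3) := filter_from setT cong3.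

Lemma entourage3_filter : Filter entourage3.
Proof.
apply: filter_from_filter; first by exists 0.
move=> i j _ _; exists (maxn i j) => // -[x y] /= xy; split => /=.
  by apply: res3_eq_le xy; rewrite leq_maxl.
by apply: res3_eq_le xy; rewrite leq_maxr.
Qed.

Lemma entourage3_diagonal A : entourage3 A -> diagonal `<=` A.
Proof. by move=> [n _ nA] [x y] /diagonalP/= ->; exact: nA. Qed.

Lemma entourage3_inv A : entourage3 A -> entourage3 A^-1.
Proof. by move=> [n _ nA]; exists n => // -[x y] /= xy; apply: nA. Qed.

Lemma entourage3_split A : entourage3 A ->
  exists2 B, entourage3 B & B \; B `<=` A.
Proof.
move=> [n _ nA]; exists (cong3 n); first by exists n.
by move=> [x y] [z /= xz zy]; apply: nA; rewrite /cong3/= xz zy.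
Qed.
End topology.

HB.instance Definition _ := isUniform.Build Z3
  entourage3_filter entourage3_diagonal entourage3_inv entourage3_split.

Section metric.
Variable R : realType.

Lemma res3_0 n : res3 0 n = 0.
Proof. exact: mod0z. Qed.

Lemma norm3_ge0 x : 0 <= norm3 R x.
Proof. by rewrite /norm3; case: ifP => // _; rewrite invr_ge0 exprn_ge0. Qed.

Lemma norm3_eq0 x : norm3 R x = 0 -> x = 0.
Proof.
rewrite /norm3; case: eqP => // _ /eqP.
by rewrite invr_eq0 expf_eq0 pnatr_eq0 andbF.
Qed.

Lemma norm3_le x n : (norm3 R x <= 3 ^- n) = (res3 x n == 0).
Proof.
rewrite /norm3; case: eqP => [->|x0].
  by rewrite res3_0 eqxx invr_ge0 exprn_ge0.
rewrite lef_pV2 ?posrE ?exprn_gt0// ler_eXn2l ?ltr1n//.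
rewrite /val3; case: pselect => [h|nh]; last first.
  exfalso; apply: x0; apply: Z3_eqP => k; rewrite res3_0 -res3E.
  have [->|k0] := eqVneq (res3 x k.+1) 0; first by rewrite mod0z.
  by exfalso; apply: nh; exists k.
case: ex_minnP => m xm mmin; apply/idP/eqP => [nm|xn].
  case: n nm => [|n] nm; first by rewrite -res3E expr0 modz1.
  by apply/eqP; apply: contraTT nm => /mmin; rewrite -leqNgt.
rewrite leqNgt; apply: contra xm => mn.
by apply/eqP; rewrite -[RHS](res3_0 m.+1); apply: res3_eq_le mn _; rewrite xn res3_0.
Qed.

Lemma norm3_lt_exp (e : R) : 0 < e -> exists n, 3 ^- n < e.
Proof.
move=> e0; exists (Num.bound e^-1).
rewrite -[ltRHS]invrK ltf_pV2 ?posrE ?invr_gt0 ?exprn_gt0//.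
have := archi_boundP (ltW (etrans (invr_gt0 e) e0)) => /lt_le_trans; apply.
by rewrite -natrX ler_nat ltnW// ltn_expl.
Qed.

Definition dist3 (x y : Z3) : R := norm3 R (x - y).

Lemma dist3_le x y n : (dist3 x y <= 3 ^- n) = (res3 x n == res3 y n).
Proof. by rewrite norm3_le res3B_eq0. Qed.

Lemma dist3xx x : dist3 x x = 0.
Proof. by rewrite /dist3 /norm3 subrr eqxx. Qed.

Lemma dist3_positivity x y : dist3 x y = 0 -> x = y.
Proof. by move=> /norm3_eq0/eqP; rewrite subr_eq0 => /eqP. Qed.

Lemma dist3_exp x y : dist3 x y = 0 \/ exists n, dist3 x y = 3 ^- n.
Proof.
by rewrite /dist3 /norm3; case: eqP => _; [left|right; exists (val3 (x - y))].
Qed.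

Lemma dist3_ge0 x y : 0 <= dist3 x y. Proof. exact: norm3_ge0. Qed.

Lemma dist3_sym x y : dist3 x y = dist3 y x.
Proof.
wlog suff : x y / dist3 x y <= dist3 y x.
  by move=> h; apply/eqP; rewrite eq_le !h.
have [/dist3_positivity ->|[n yx]] := dist3_exp y x; first by rewrite dist3xx.
by rewrite yx dist3_le eq_sym -dist3_le yx.
Qed.

Lemma dist3_ultra x y z : dist3 x z <= Num.max (dist3 x y) (dist3 y z).
Proof.
have h (a b c : Z3) : dist3 a b <= dist3 b c -> dist3 a c <= dist3 b c.
  have [/dist3_positivity ->|[n bc]] := dist3_exp b c.
    by [].
  rewrite bc !dist3_le => /eqP ->.
  by rewrite -dist3_le bc.
rewrite le_max; have [xy|yx] := leP (dist3 x y) (dist3 y z).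
  by rewrite h ?orbT.
rewrite [dist3 x z]dist3_sym [dist3 x y]dist3_sym h//.
by rewrite [dist3 z y]dist3_sym [dist3 y x]dist3_sym ltW.
Qed.

Lemma dist3_triangle y x z : dist3 x z <= dist3 x y + dist3 y z.
Proof.
rewrite (le_trans (dist3_ultra x y z))// ge_max lerDl lerDr.
by rewrite !dist3_ge0.
Qed.

Definition ball3 (x : Z3) (e : R) : set Z3 := [set y | dist3 x y < e].

Lemma ball3_center x (e : R) : 0 < e -> ball3 x e x.
Proof. by rewrite /ball3/= dist3xx. Qed.

Lemma ball3_sym x y (e : R) : ball3 x e y -> ball3 y e x.
Proof. by rewrite /ball3/= dist3_sym. Qed.

Lemma ball3_triangle x y z e1 e2 :
  ball3 x e1 y -> ball3 y e2 z -> ball3 x (e1 + e2) z.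
Proof.
rewrite /ball3/= => xy yz.
by rewrite (le_lt_trans (dist3_triangle y _ _))// ltrD.
Qed.

Lemma entourage3E : entourage = entourage_ ball3.
Proof.
apply/seteqP; split => A.
  move=> [n _ nA]; exists (3 ^- n); first by rewrite /= invr_gt0 exprn_gt0.
  by move=> [x y] /ltW /=; rewrite dist3_le => /eqP xy; apply: nA.
move=> [e /= /norm3_lt_exp[n ne] eA]; exists n => // -[x y] /= /eqP xy.
by apply: eA; rewrite /ball3/= (le_lt_trans _ ne)// dist3_le.
Qed.

HB.instance Definition _ := @Uniform_isPseudoMetric.Build R Z3
  ball3 ball3_center ball3_sym ball3_triangle entourage3E.

HB.instance Definition _ := @PseudoMetric_isMetric.Build R Z3
  dist3 dist3_ge0 dist3_positivity (fun _ _ => erefl).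

End metric.

Section hausdorff.
Variables (R : realType) (T : metricType R).
Local Open Scope ereal_scope.

(* [maxe 0] only matters for the empty set, whose supremum is -oo. *)
Definition diam (A : set T) : \bar R :=
  maxe 0 (ereal_sup [set (mdist xy.1 xy.2)%:E | xy in A `*` A]).

(* The empty set has weight 0 also for s = 0, where 0 `^ 0 = 1. *)
Definition diam_pow (s : R) (A : set T) : \bar R :=
  if `[< A = set0 >] then 0 else diam A `^ s.

Definition hausdorff_content (s delta : R) (A : set T) : \bar R :=
  ereal_inf [set \sum_(0 <= k <oo) diam_pow s (U k) | U in
    [set U : nat -> set T | A `<=` \bigcup_k U k /\
                            forall k, diam (U k) <= delta%:E]].

Definition hausdorff_measure (s : R) (A : set T) : \bar R :=
  ereal_sup [set hausdorff_content s delta A | delta in [set d | (0 < d)%R]].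

Definition hausdorff_dim (A : set T) : \bar R :=
  ereal_inf [set s%:E | s in
    [set s : R | (0 <= s)%R /\ hausdorff_measure s A = 0]].

End hausdorff.

Definition Sigma3 : set Z3 :=
  [set x | exists a : nat -> nat, (forall j, (a j = 0 \/ a j = 1)%N) /\
     series (fun j => (a j)%:R * 3 ^+ j : Z3) @ \oo --> x].

Definition exceptional_multipliers (x : Z3) : set nat :=
  [set M | [/\ (1 <= M)%N, ~~ (3 %| M)%N & Sigma3 (M%:R * x)]].

Definition generalized_exceptional_set : set Z3 :=
  [set x | infinite_set (exceptional_multipliers x) /\
           exceptional_multipliers x 1%N].

Definition log3_2 (R : realType) : R := ln 2 / ln 3.

(* Main.v *)
(* Put [b_0, b_1, ...] in {0, 1} on the even places: [x = sum_j b_j 9^j].  For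
   odd m the digits of 3^m x sit on the odd places, so x + 3^m x has no carries
   and only digits 0 and 1: every such x lies in both sets.
   These x form a Cantor set in which a set of diameter at most 3^-n meets a
   single cylinder with ceil(n/2) prescribed digits, of mass
   2^-ceil(n/2) <= (3^-n)^s for s <= (log_3 2)/2.  A cover with a small s-sum
   thus yields cylinders of total mass below 1, and these cannot cover {0,1}^N. *)
Require Import Defs.
From HB Require Import structures.
From mathcomp Require Import all_boot all_order all_algebra.
From mathcomp Require Import all_classical all_reals all_analysis.
From mathcomp Require Import ring lra zify.

Import Order.TTheory GRing.Theory Num.Theory.
Import numFieldNormedType.Exports.

Local Open Scope classical_set_scope.
Local Open Scope ring_scope.

(** * Cylinder masses on the Cantor space *)

(* The proportion of the cylinder of the word [w] lying in the cylinder that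
   prescribes the first [h] digits to be those of [c]; the truncated [h - size w]
   makes it 1 when [w] is at least as long as [h] and agrees with [c]. *)
Definition cylinder_mass (R : realType) (h : nat) (c : nat -> bool)
    (w : seq bool) : R :=
  if all (fun i => nth false w i == c i) (iota 0 (minn (size w) h))
  then 2 ^- (h - size w) else 0.

Lemma cylinder_mass_ge0 (R : realType) h c w : 0 <= cylinder_mass R h c w.
Proof. by rewrite /cylinder_mass; case: ifP => // _; rewrite invr_ge0 exprn_ge0. Qed.

(** While [w] is shorter than [h], its next digit is prescribed: one extension gets twice the mass
    of [w], the other 0. From length [h] on, both extensions keep the mass. *)
Lemma cylinder_mass_rcons (R : realType) h c w :
  cylinder_mass R h c (rcons w false) + cylinder_mass R h c (rcons w true) =
  2 * cylinder_mass R h c w.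
Proof.
have agree b k : (k <= size w)%N ->
    all (fun i => nth false (rcons w b) i == c i) (iota 0 k) =
    all (fun i => nth false w i == c i) (iota 0 k).
  move=> kw; apply: eq_in_all => i; rewrite mem_iota add0n => /andP[_ ik].
  by rewrite nth_rcons (leq_trans ik kw).
rewrite /cylinder_mass !size_rcons.
have [hw|wh] := leqP h (size w).
  rewrite !(minn_idPr _) ?(leqW hw)// !agree//.
  have -> : (h - size w = 0)%N by lia.
  have -> : (h - (size w).+1 = 0)%N by lia.
  by case: ifP => _; ring.
rewrite !(minn_idPl _) ?(ltnW wh)// -addn1 iotaD !all_cat !agree//= add0n.
rewrite !nth_rcons ltnn eqxx !andbT addn1.
have -> : (h - size w = (h - (size w).+1).+1)%N by lia.
rewrite exprS; set x := 2 ^+ _.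
have x0 : x != 0 by rewrite expf_eq0 pnatr_eq0 andbF.
case: (all _ _) => /=; last by ring.
by case: (c _) => /=; field.
Qed.

(* Averaging: the total mass of the cylinders relative to a word is the mean of
   the masses relative to its two extensions, so starting from a total mass
   below 1 one can follow a branch along which it stays below 1; no cylinder
   can contain that branch, as it would contribute 1 on its own. *)
Lemma cantor_not_covered (R : realType) (h : nat -> nat) (c : nat -> nat -> bool) :
  (\sum_(0 <= k <oo) (2 ^- h k : R)%:E < 1)%E ->
  exists b : nat -> bool, forall k, exists2 i, (i < h k)%N & b i <> c k i.
Proof.
pose S w := (\sum_(0 <= k <oo) (cylinder_mass R (h k) (c k) w)%:E)%E.
have Spos w k : (0 <= (cylinder_mass R (h k) (c k) w)%:E)%E.
  by rewrite lee_fin cylinder_mass_ge0.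
have S0E : (\sum_(0 <= k <oo) (2 ^- h k : R)%:E)%E = S [::].
  apply: eq_eseriesr => k _; rewrite /cylinder_mass /= min0n /=.
  by rewrite subn0.
rewrite S0E => S0.
have Sstep w : (S w < 1)%E -> exists b, (S (rcons w b) < 1)%E.
  move=> Sw; have [|f1] := ltP (S (rcons w false)) 1%E; first by exists false.
  have [|t1] := ltP (S (rcons w true)) 1%E; first by exists true.
  have := leeD f1 t1; rewrite -nneseriesD//.
  under eq_eseriesr do rewrite -EFinD cylinder_mass_rcons EFinM.
  rewrite nneseriesZl// -/(S w) leNgt => /negP[].
  have Sfin : S w \is a fin_num.
    by rewrite ge0_fin_numE ?nneseries_ge0// (lt_trans Sw)// ltry.
  move: Sw; rewrite -(fineK Sfin) lte_fin => Sw.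
  by rewrite -EFinM -EFinD lte_fin; lra.
have [next nextP] : {next : seq bool -> bool &
    forall w, (S w < 1)%E -> (S (rcons w (next w)) < 1)%E}.
  by apply: (@choice _ _ (fun w b => (S w < 1)%E -> (S (rcons w b) < 1)%E)) => w;
    have [/Sstep[b bP]|] := boolP (S w < 1)%E; [exists b|exists false].
pose W := fix W n := if n is n.+1 then rcons (W n) (next (W n)) else [::].
have sW n : size (W n) = n by elim: n => //= n ih; rewrite size_rcons ih.
have SW n : (S (W n) < 1)%E by elim: n => //= n ih; apply: nextP.
have nthW n i : (i < n)%N -> nth false (W n) i = next (W i).
  elim: n => // n ih; rewrite ltnS leq_eqVlt /= nth_rcons sW => /predU1P[->|i_n].
    by rewrite ltnn eqxx.
  by rewrite i_n ih.
exists (fun i => next (W i)) => k; apply/not_exists2P => bc.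
have := SW (h k); apply/negP; rewrite -leNgt.
apply: le_trans (nneseries_lim_ge k.+1 _) => //.
rewrite big_nat_recr//= -[leLHS]add0e leeD ?sume_ge0//.
rewrite /cylinder_mass sW minnn subnn expr0 invr1 ifT//.
apply/allP => i; rewrite mem_iota add0n => /andP[_ ik].
by rewrite nthW//; case: (bc i) => // /contrapT/eqP.
Qed.

(** * Ternary digit sequences and their sums *)

Lemma PoszX3 n : (3 ^ n)%N = 3 ^+ n :> int.
Proof. by rewrite -natz natrX. Qed.

Definition digit_sum (a : nat -> nat) (n : nat) : nat :=
  (\sum_(i < n) a i * 3 ^ i)%N.

Lemma digit_sumS a n : digit_sum a n.+1 = (digit_sum a n + a n * 3 ^ n)%N.
Proof. by rewrite /digit_sum big_ord_recr. Qed.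

Lemma digit_sum_mod a m n : (n <= m)%N ->
  (digit_sum a m = digit_sum a n %[mod 3 ^ n])%N.
Proof.
elim: m => [|m ih]; first by rewrite leqn0 => /eqP->.
rewrite leq_eqVlt => /predU1P[->//|nm].
by rewrite digit_sumS -(subnK (ltnSE nm)) expnD mulnA addnC modnMDl subnK ?ih.
Qed.

Lemma digit_sum_lt a n : (forall i, (a i < 3)%N) -> (digit_sum a n < 3 ^ n)%N.
Proof.
move=> a3; elim: n => [|n ih]; first by rewrite /digit_sum big_ord0.
rewrite digit_sumS expnS.
have : (a n * 3 ^ n <= 2 * 3 ^ n)%N by rewrite leq_mul2r -ltnS a3 orbT.
by lia.
Qed.

Lemma digit_sumD a b n :
  digit_sum (fun i => a i + b i)%N n = (digit_sum a n + digit_sum b n)%N.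
Proof.
by rewrite /digit_sum -big_split; apply: eq_bigr => i _; rewrite mulnDl.
Qed.

Definition shift_digits (m : nat) (a : nat -> nat) (i : nat) : nat :=
  if (m <= i)%N then a (i - m)%N else 0%N.

Lemma digit_sum_shift m a n :
  digit_sum (shift_digits m a) (m + n) = (3 ^ m * digit_sum a n)%N.
Proof.
rewrite /digit_sum big_split_ord /= big1 => [|i _]; last first.
  by rewrite /shift_digits leqNgt ltn_ord.
rewrite add0n big_distrr; apply: eq_bigr => i _ /=.
by rewrite /shift_digits leq_addr addKn expnD mulnCA.
Qed.

Lemma digits3_subproof (a : nat -> nat) n :
  ((digit_sum a n.+1)%:Z %% 3 ^+ n = (digit_sum a n)%:Z %% 3 ^+ n)%Z.
Proof. by rewrite digit_sumS PoszD PoszM PoszX3 addrC modzMDl. Qed.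

(** The digits may be arbitrary naturals, so that sequences can be added entrywise without carries;
    bounds are imposed only where needed. *)
Definition digits3 (a : nat -> nat) : Z3 :=
  MkZ3 (trunc3_subproof (digits3_subproof a)).

Lemma res3_digits a n : res3 (digits3 a) n = (digit_sum a n %% 3 ^ n)%N.
Proof. by rewrite -modz_nat PoszX3. Qed.

Lemma res3_natr m n : res3 m%:R n = (m %% 3 ^ n)%N.
Proof.
rewrite -modz_nat PoszX3.
elim: m => [|m ih]; first by rewrite res3_0 mod0z.
by rewrite -natr1 res3D ih /= modzDm -PoszD addn1.
Qed.

Lemma series_digits3 a :
  series (fun j => (a j)%:R * 3 ^+ j : Z3) @ \oo --> digits3 a.
Proof.
apply/cvg_entourageP => A [n _ nA]; exists n => // m /= nm; apply: nA.
have sE : series (fun j => (a j)%:R * 3 ^+ j : Z3) m = (digit_sum a m)%:R :> Z3.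
  rewrite /series /= big_mkord natr_sum; apply: eq_bigr => i _.
  by rewrite natrM natrX.
change (res3 (digits3 a) n = res3 (series (fun j => (a j)%:R * 3 ^+ j : Z3) m) n).
by rewrite sE res3_natr res3_digits digit_sum_mod.
Qed.

Lemma Sigma3_digits3 a : (forall i, (a i < 2)%N) -> Sigma3 (digits3 a).
Proof.
move=> a2; exists a; split; last exact: series_digits3.
by move=> j; case: (a j) (a2 j) => [|[|]] // _; [left|right].
Qed.

(** For digits below 3 the residue modulo [3 ^ n] is the digit sum itself; reducing it modulo the
    next lower power splits off the top digit. *)
Lemma digits3_inj a b n : (forall i, (a i < 3)%N) -> (forall i, (b i < 3)%N) ->
  res3 (digits3 a) n = res3 (digits3 b) n -> forall i, (i < n)%N -> a i = b i.
Proof.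
move=> a3 b3; rewrite !res3_digits !modn_small ?digit_sum_lt// => -[].
elim: n => // n ih; rewrite !digit_sumS => abn i.
have n0 : (0 < 3 ^ n)%N by rewrite expn_gt0.
have abn' : digit_sum a n = digit_sum b n.
  have := congr1 (modn^~ (3 ^ n)%N) abn.
  by rewrite ![(_ + _ * _)%N]addnC !modnMDl !modn_small ?digit_sum_lt.
rewrite ltnS leq_eqVlt => /predU1P[->|]; last exact: ih.
by move/eqP: abn; rewrite abn' eqn_add2l eqn_pmul2r// => /eqP.
Qed.

Lemma mul_digits3 a m :
  (3 ^ m + 1)%N%:R * digits3 a = digits3 (fun i => a i + shift_digits m a i)%N.
Proof.
apply: Z3_eqP => n; rewrite res3_digits digit_sumD.
have res3M (x y : Z3) : res3 (x * y) n = (res3 x n * res3 y n %% 3 ^+ n)%Z by [].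
rewrite res3M res3_natr res3_digits -PoszX3 -PoszM modz_nat modnMm.
(* The multiple by [3 ^ m] is a shifted sum of length [m + n]; modulo [3 ^ n] it may be cut back to
   length [n]. *)
rewrite mulnDl mul1n addnC -modnDmr -digit_sum_shift.
by rewrite (@digit_sum_mod _ (m + n) n) ?leq_addl// modnDmr.
Qed.

(** * Points with digits on the even places *)

Definition even_digits (b : nat -> bool) (j : nat) : nat := ~~ odd j && b j./2.

Definition even_point (b : nat -> bool) : Z3 := digits3 (even_digits b).

Lemma Sigma3_even_point b : Sigma3 (even_point b).
Proof. by apply: Sigma3_digits3 => i; rewrite /even_digits; case: (_ && _). Qed.

Lemma Sigma3_mul_even_point b m : odd m ->
  Sigma3 ((3 ^ m + 1)%N%:R * even_point b).
Proof.
move=> m_odd; rewrite mul_digits3; apply: Sigma3_digits3 => i.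
rewrite /shift_digits /even_digits.
case: (leqP m i) => [mi|_] /=; last by case: (_ && _).
(* [i] and [i - m] have opposite parity, so at most one of the two digits is nonzero. *)
by rewrite (oddB mi) m_odd addbT; case: (odd i) => /=; case: (b _).
Qed.

(** There are [uphalf n] even places below [n]. *)
Lemma even_point_inj b c n : res3 (even_point b) n = res3 (even_point c) n ->
  forall i, (i < uphalf n)%N -> b i = c i.
Proof.
have even3 d i : (even_digits d i < 3)%N.
  by rewrite /even_digits; case: (_ && _).
move=> bc i; rewrite -(ltn_double i) => ihn.
have := @digits3_inj _ _ _ (even3 b) (even3 c) bc i.*2.
rewrite /even_digits odd_double doubleK /= => bci.
suff : b i = c i :> nat by case: (b i); case: (c i).
by apply: bci; move: ihn; rewrite -!mul2n; have := odd_double_half n; lia.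
Qed.

Lemma exceptional_even_point b : generalized_exceptional_set (even_point b).
Proof.
have mult m : odd m -> exceptional_multipliers (even_point b) (3 ^ m + 1)%N.
  move=> mo; split; [by rewrite addn1| |exact: Sigma3_mul_even_point].
  by case: m mo => // m _; rewrite dvdn_addr// expnS dvdn_mulr.
split; last by split => //; rewrite mul1r; exact: Sigma3_even_point.
(* A finite set of multipliers would have a finite preimage under the injection below, yet this
   preimage is all of [nat]. *)
move=> fin; apply: infinite_nat.
have fI : injective (fun k => 3 ^ k.*2.+1 + 1)%N.
  move=> i j /eqP; rewrite eqn_add2r eqn_exp2l// eqSS => /eqP.
  exact: double_inj.
apply: sub_finite_set (finite_preimage (in2W fI) fin) => k _ /=.
by apply: mult; rewrite /= odd_double.
Qed.

(** * Numerical bounds on the logarithm *)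

(** Serves to turn comparisons of integer powers into rational bounds on [log3_2]. *)
Lemma ln_nat_pow_le (R : realType) (a b p q : nat) :
  (0 < a)%N -> (0 < b)%N -> (a ^ p <= b ^ q)%N ->
  p%:R * ln a%:R <= q%:R * ln b%:R :> R.
Proof.
move=> a0 b0 ab; rewrite !mulr_natl -!lnXn ?ltr0n//.
by rewrite ler_ln ?posrE ?exprn_gt0 ?ltr0n// -!natrX ler_nat.
Qed.

(* 665/1054 is a convergent of log_3 2 and 971/1539 the mediant of it and the
   preceding convergent 306/485. *)
Lemma exp3_971_le : (3 ^ 971 <= 2 ^ 1539)%N.
Proof. lia. Qed.

Lemma exp2_1054_le : (2 ^ 1054 <= 3 ^ 665)%N.
Proof. lia. Qed.

Lemma log3_2_bounds (R : realType) :
  315 / 10 ^+ 3 + 464 / 10 ^+ 6 <= 2^-1 * log3_2 R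
    < 315 / 10 ^+ 3 + 465 / 10 ^+ 6.
Proof.
have ln3 : 0 < ln 3 :> R by rewrite ln_gt0// ltr1n.
have ln2E : ln 2 = log3_2 R * ln 3 by rewrite /log3_2 divfK// gt_eqF.
have := @ln_nat_pow_le R 3 2 _ _ isT isT exp3_971_le.
have := @ln_nat_pow_le R 2 3 _ _ isT isT exp2_1054_le.
rewrite ln2E !mulrA !ler_pM2r//.
by move=> h1 h2; apply/andP; split; lra.
Qed.

(** * From covers to the dimension bound *)

(** In logarithms this combines [s * ln 3 <= ln 2 / 2] with [n <= 2 * uphalf n]. The extra 1 in
    [n.+1] costs a factor [3 ^ s], which the constant 3 absorbs as [s <= 1]. *)
Lemma even_level_weight (R : realType) (s d : R) n :
  0 <= s <= 2^-1 * log3_2 R -> 3 ^- n.+1 < d -> 2 ^- uphalf n <= 3 * d `^ s.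
Proof.
move=> /andP[s0 st] nd.
have d0 : 0 < d by rewrite (lt_trans _ nd)// invr_gt0 exprn_gt0.
have ln3 : 0 < ln 3 :> R by rewrite ln_gt0// ltr1n.
have ln2E : ln 2 = log3_2 R * ln 3 by rewrite /log3_2 divfK// gt_eqF.
have ln2 : 0 < ln 2 :> R by rewrite ln_gt0// ltr1n.
have s1 : s <= 1 by have /andP[_] := log3_2_bounds R; lra.
rewrite -ler_ln ?posrE ?mulr_gt0 ?powR_gt0 ?invr_gt0 ?exprn_gt0//.
rewrite lnV ?posrE ?exprn_gt0// lnM ?posrE ?powR_gt0// ln_powR lnXn//.
rewrite -[_ *+ uphalf n]mulr_natl.
have lnd : - (n%:R + 1) * ln 3 <= ln d.
  move: nd; rewrite -ltr_ln ?posrE ?invr_gt0 ?exprn_gt0//.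
  rewrite lnV ?posrE ?exprn_gt0// lnXn// -[_ *+ _]mulr_natl -natr1 => /ltW.
  by rewrite mulNr.
have sd := ler_wpM2l s0 lnd.
have s3 : s * ln 3 <= ln 2 / 2 by rewrite ln2E; nra.
have nU : n%:R <= 2 * (uphalf n)%:R :> R.
  by rewrite -natrM ler_nat; have := odd_double_half n; rewrite uphalf_half; lia.
have s3n : n%:R * (s * ln 3) <= n%:R * (ln 2 / 2) by apply: ler_wpM2l.
have nU2 : n%:R * ln 2 <= 2 * (uphalf n)%:R * ln 2 :> R by rewrite ler_pM2r.
have s13 : s * ln 3 <= ln 3 :> R by rewrite ler_piMl// ltW.
by lra.
Qed.

Lemma exp2V_le (R : realType) (e : R) : 0 < e -> exists n, 2 ^- n <= e.
Proof.
move=> e0; exists (Num.bound e^-1).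
rewrite -[leRHS]invrK lef_pV2 ?posrE ?invr_gt0 ?exprn_gt0//.
have /ltW/le_trans := archi_boundP (ltW (etrans (invr_gt0 e) e0)); apply.
by rewrite -natrX ler_nat ltnW// ltn_expl.
Qed.

Lemma diam_pow_ge0 (R : realType) (T : metricType R) (s : R) (A : set T) :
  (0 <= diam_pow s A)%E.
Proof. by rewrite /diam_pow; case: ifP => // _; exact: poweR_ge0. Qed.

Lemma mdist_le_diam (R : realType) (T : metricType R) (A : set T) x y :
  A x -> A y -> ((mdist x y)%:E <= diam A)%E.
Proof.
move=> Ax Ay; rewrite /diam le_max; apply/orP; right.
by apply: ereal_sup_ubound; exists (x, y).
Qed.

(** The slack [e] serves the sets whose weight may vanish, namely those without even points and
    those of diameter 0: a cylinder of mass at most [e] suffices there. *)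
Lemma even_cylinder (R : realType) (s e : R) (U : set Z3) :
  0 <= s <= 2^-1 * log3_2 R -> 0 < e -> (@diam R Z3 U <= 1)%E ->
  exists hc : nat * (nat -> bool),
    ((2 ^- hc.1)%:E <= 3%:E * @diam_pow R Z3 s U + e%:E)%E /\
    forall b, U (even_point b) -> forall i, (i < hc.1)%N -> b i = hc.2 i.
Proof.
move=> st e0 U1.
have [h he] := exp2V_le R e e0.
have heU : ((2 ^- h)%:E <= 3%:E * @diam_pow R Z3 s U + e%:E)%E.
  rewrite -[leLHS]add0e leeD ?lee_fin//.
  by rewrite mule_ge0 ?lee_fin// diam_pow_ge0.
have [[c Uc]|noc] := pselect (exists c, U (even_point c)); last first.
  by exists (h, fun=> false); split => // b Ub; case: noc; exists b.
have diam0 : (0 <= @diam R Z3 U)%E by rewrite /diam le_max lexx.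
have [d dE] : exists d, @diam R Z3 U = d%:E.
  exists (fine (@diam R Z3 U)); rewrite fineK// ge0_fin_numE//.
  by rewrite (le_lt_trans U1)// ltry.
move: diam0 U1; rewrite dE !lee_fin => d0 d1.
have distU b : U (even_point b) -> dist3 R (even_point b) (even_point c) <= d.
  by move=> Ub; rewrite -lee_fin -dE; exact: (@mdist_le_diam R Z3).
have [d_eq0|d_neq0] := eqVneq d 0.
  exists (h, c); split => // b /distU; rewrite d_eq0 => bc i _.
  have /(@dist3_positivity R) {}bc : dist3 R (even_point b) (even_point c) = 0.
    by apply/eqP; rewrite eq_le bc dist3_ge0.
  apply: (@even_point_inj b c i.+1.*2); first by rewrite bc.
  by rewrite uphalf_double.
have dgt0 : 0 < d by rewrite lt0r d_neq0.
(* The least such [n] gives [3 ^- n.+1 < d <= 3 ^- n], where the case [n = 0] uses [d <= 1]. *)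
have level : exists n, 3 ^- n.+1 < d.
  have [n nd] := norm3_lt_exp dgt0; exists n; rewrite (le_lt_trans _ nd)//.
  by rewrite lef_pV2 ?posrE ?exprn_gt0// ler_eXn2l// ltr1n.
case: (ex_minnP level) => n nd nmin.
have dn : d <= 3 ^- n.
  case: n nmin {nd} => [|n] nmin; first by rewrite expr0 invr1.
  by rewrite leNgt; apply/negP => /nmin; rewrite ltnn.
exists (uphalf n, c); split => /=; last first.
  move=> b /distU bd; apply: even_point_inj.
  by apply/eqP; rewrite -(@dist3_le R); apply: le_trans dn.
rewrite /diam_pow asboolF; last by move=> U0; rewrite U0 in Uc.
rewrite dE poweR_EFin -EFinM -EFinD lee_fin.
by apply: le_trans (even_level_weight R s d n st nd) _; rewrite lerDl ltW.
Qed.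

Lemma even_dim_ge (R : realType) (A : set Z3) :
  (forall b, A (even_point b)) ->
  ((2^-1 * log3_2 R)%:E <= @hausdorff_dim R Z3 A)%E.
Proof.
move=> KA; apply: le_ereal_inf_tmp => _ [s [s0 As] <-]; rewrite lee_fin leNgt.
apply/negP => /ltW st.
(* The measure is a supremum over scales, so the content at scale 1 vanishes too. With slacks of sum
   at most 1/4, the bound 1/8 keeps the total mass below 3/8 + 1/4 < 1. *)
have {As} : (@hausdorff_content R Z3 s 1 A < 8^-1%:E)%E.
  rewrite (@le_lt_trans _ _ 0%E)// ?lte_fin// -As.
  by apply: ereal_sup_ubound; exists 1 => /=.
move=> /ereal_inf_lt[_ [U [AU U1] <-] sumU].
have e_gt0 k : 0 < 4^-1 / (2 ^ k.+1)%:R :> R.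
  by rewrite divr_gt0// ltr0n expn_gt0.
have [hc hcP] := choice (fun k =>
  @even_cylinder R s _ (U k) (introT andP (conj s0 st)) (e_gt0 k) (U1 k)).
have [|b bhc] := @cantor_not_covered R (fun k => (hc k).1) (fun k => (hc k).2).
  have dpos k : (0 <= 3%:E * @diam_pow R Z3 s (U k))%E.
    by rewrite mule_ge0 ?lee_fin// diam_pow_ge0.
  apply: (@le_lt_trans _ _
    (\sum_(0 <= k <oo) (3%:E * @diam_pow R Z3 s (U k) +
                        (4^-1 / (2 ^ k.+1)%:R)%:E))%E).
    apply: lee_nneseries => [k _ _|k _]; last by have [] := hcP k.
    by rewrite lee_fin invr_ge0 exprn_ge0.
  apply: le_lt_trans (epsilon_trick xpredT dpos _) _; first by [].
  rewrite nneseriesZl => [|k _]; last exact: diam_pow_ge0.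
  have sfin : (\sum_(0 <= k <oo) @diam_pow R Z3 s (U k))%E \is a fin_num.
    rewrite ge0_fin_numE ?(lt_trans sumU) ?ltry// nneseries_ge0// => k _ _.
    exact: diam_pow_ge0.
  by move: sumU; rewrite -(fineK sfin) -EFinM -EFinD !lte_fin; lra.
have [k _ Uk] := AU _ (KA b).
by have [i ih] := bhc k; have [_ /(_ b Uk i ih)] := hcP k.
Qed.

Theorem theorem1p9 (R : realType) :
  [/\ ((2^-1 * log3_2 R)%:E
        <= @hausdorff_dim R Z3 generalized_exceptional_set)%E,
      (315 / 10 ^+ 3 + 464 / 10 ^+ 6 <= 2^-1 * log3_2 R
        < 315 / 10 ^+ 3 + 465 / 10 ^+ 6) &
      ((2^-1 * log3_2 R)%:E
        <= @hausdorff_dim R Z3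
             [set x : Z3 | Sigma3 x /\
                forall k : nat, (1 <= k)%N ->
                  Sigma3 ((3 ^ (2 * k + 1) + 1)%N%:R * x)%R])%E].
Proof.
split; last 1 first.
- apply: even_dim_ge => b; split => [|k _]; first exact: Sigma3_even_point.
  by apply: Sigma3_mul_even_point; rewrite addn1 /= mul2n odd_double.
- by apply: even_dim_ge => b; exact: exceptional_even_point.
- exact: log3_2_bounds.
Qed.
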